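(* Let $(\mathcal M,[\,,\,],\langle\,,\,\rangle)$ be a flat Lorentzian nilpotent Malcev algebra. Then $(\mathcal M,[\,,\,],\langle\,,\,\rangle)$ is a flat double extension of a flat Euclidean abelian Lie algebra $(\overline{\mathcal M},[\,,\,]_{\overline{\mathcal M}},\langle\,,\,\rangle_{\overline{\mathcal M}})$ by means of $(D,\xi,b_0,0)$ with $\xi=-D$, $\xi^2=0$ and $b_0\in\overline{\mathcal M}$. Furthermore, $(\mathcal M,[\,,\,])$ is at most $3$-step nilpotent, i.e. $[[[u,v],w],z]=0$ for all $u,v,w,z\in\mathcal M$.
   Context: All vector spaces are finite dimensional; here the base field is $\mathbb K=\mathbb R$. A Malcev algebra is a vector space with an anti-symmetric bilinear bracket satisfying $J(u,v,[u,w])=[J(u,v,w),u]$, where $J(u,v,w)=[[u,v],w]+[[w,u],v]+[[v,w],u]$. It is nilpotent if its lower central series $\mathcal M^1=\mathcal M$, $\mathcal M^{k+1}=[\mathcal M^k,\mathcal M]$ reaches $0$. A pseudo-Euclidean Malcev algebra is a Malcev algebra with a non-degenerate symmetric bilinear form; it is Euclidean if the form is positive definite (the zero space being allowed), Lorentzian if the form has signature $(1,n-1)$ (one minus sign), with $n=\dim\mathcal M\ge 2$. The Levi-Civita product $\bullet$ is defined by $2\langle u\bullet v,w\rangle=\langle[u,v],w\rangle-\langle[v,w],u\rangle+\langle[w,u],v\rangle$; $\mathrm L_u(v)=u\bullet v$. The algebra is flat if $K=0$, where $$K(u,v,w)=\mathrm L_{[[u,v],w]}-\mathrm L_{[u,w]}\circ\mathrm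 L_v-\mathrm L_u\circ\mathrm L_{[v,w]}+\mathrm L_v\circ\mathrm L_u\circ\mathrm L_w-\mathrm L_w\circ\mathrm L_v\circ\mathrm L_u.$$ Flat double extension: let $(\overline{\mathcal M},[\,,\,]_{\overline{\mathcal M}},\langle\,,\,\rangle_{\overline{\mathcal M}})$ be a flat pseudo-Euclidean Malcev algebra with Levi-Civita product $\bullet_{\overline{\mathcal M}}$, $D,\xi\in\mathrm{End}(\overline{\mathcal M})$, $b_0\in\overline{\mathcal M}$, $\lambda\in\mathbb K$. A flat pseudo-Euclidean Malcev algebra is a flat double extension of $\overline{\mathcal M}$ by means of $(D,\xi,b_0,\lambda)$ if it is isometrically isomorphic to $\mathbb Kd\oplus\overline{\mathcal M}\oplus\mathbb Ke$ with the bracket $$[d,e]=\lambda e,\quad [d,u]=D(u)+\langle b_0,u\rangle_{\overline{\mathcal M}}e,\quad [e,u]=0,\quad [u,v]=[u,v]_{\overline{\mathcal M}}-\langle(\xi-\xi^* )(u),v\rangle_{\overline{\mathcal M}}e,$$ the form extending $\langle\,,\,\rangle_{\overline{\mathcal M}}$ with $\langle e,d\rangle=1$, $\langle d,d\rangle=\langle e,e\rangle=0$, $\langle d,\overline{\mathcal M}\rangle=\langle e,\overline{\mathcal M}\rangle=0$, and whose Levi-Civita product is $e\bullet e=e\bullet u=u\bullet e=e\bullet d=0$, $d\bullet e=\lambda e$, $d\bullet u=(D+\xi)(u)+\langle b_0,u\rangle_{\overline{\mathcal M}}e$, $u\bullet d=\xi(u)$, $d\bullet d=-b_0-\lambda d$,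 $u\bullet v=u\bullet_{\overline{\mathcal M}}v-\langle\xi(u),v\rangle_{\overline{\mathcal M}}e$, for $u,v\in\overline{\mathcal M}$ ($\xi^*$ is the adjoint of $\xi$). *)

(* Defs.v *)
From HB Require Import structures.
From mathcomp Require Import all_boot all_order all_algebra.
From mathcomp Require Import boolp classical_sets reals ring.

Set Implicit Arguments.
Unset Strict Implicit.
Unset Printing Implicit Defensive.

Import Order.TTheory GRing.Theory Num.Theory.

Local Open Scope ring_scope.

Section Algebra.
Variables (R : realType) (V : vectType R).

Section Bracket.
Variable br : {bilinear V -> V -> V}.

Definition jacobiator (u v w : V) : V :=
  br (br u v) w + br (br w u) v + br (br v w) u.

Definition antisymmetric_bracket : Prop := forall u v, br u v = - br v u.

Definition malcev_algebra : Prop :=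
  antisymmetric_bracket /\
  forall u v w, jacobiator u v (br u w) = br (jacobiator u v w) u.

Definition lie_algebra : Prop :=
  antisymmetric_bracket /\ forall u v w, jacobiator u v w = 0.

Definition abelian_bracket : Prop := forall u v, br u v = 0.

(* By bilinearity, the span of all brackets [u, v] with u in U and v in W;
   see [bracketvP]. *)
Definition bracketv (U W : {vspace V}) : {vspace V} :=
  <<[seq br u v | u <- vbasis U, v <- vbasis W]>>%VS.

(* The indices are shifted: [lower_central k] is M^(k+1), so that
   [lower_central 0] is M itself. *)
Definition lower_central (k : nat) : {vspace V} :=
  iter k (fun U => bracketv U fullv) fullv.

Definition nilpotent_of_step_at_most (k : nat) : Prop :=
  lower_central k = 0%VS.

Definition nilpotent_algebra : Prop :=
  exists k, nilpotent_of_step_at_most k.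

End Bracket.

(* The number p counts the minus signs. *)
Definition has_signature (g : {symmetric V}) (p q : nat) : Prop :=
  exists e : (p + q).-tuple V, basis_of fullv e /\
    forall i j : 'I_(p + q),
      g e`_i e`_j = if i == j then (if (i < p)%N then -1 else 1) else 0.

Definition positive_definite (g : {symmetric V}) : Prop :=
  forall u, u != 0 -> 0 < g u u.

Definition pseudo_euclidean_malcev (br : {bilinear V -> V -> V})
    (g : {symmetric V}) : Prop :=
  malcev_algebra br /\ nondegenerate g.

Definition lorentzian_malcev (br : {bilinear V -> V -> V})
    (g : {symmetric V}) : Prop :=
  [/\ pseudo_euclidean_malcev br g, (2 <= \dim {:V})%N
    & has_signature g 1 (\dim {:V}).-1].

Section MetricOperations.
Variable g : V -> V -> R.

(* The vector x such that <x, w> = phi w for all w; it exists and is unique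
   when g is non-degenerate and phi is linear (see [rieszP] and
   [riesz_unique]). *)
Definition riesz (phi : V -> R) : V := xget 0 [set x | forall w, g x w = phi w].

Definition adjoint (f : V -> V) (u : V) : V := riesz (fun v => g u (f v)).

Definition levi_civita (br : V -> V -> V) (u v : V) : V :=
  riesz (fun w => 2^-1 * (g (br u v) w - g (br v w) u + g (br w u) v)).

Definition curvature (br : V -> V -> V) (u v w x : V) : V :=
  let L := levi_civita br in
  L (br (br u v) w) x - L (br u w) (L v x) - L u (L (br v w) x)
  + L v (L u (L w x)) - L w (L v (L u x)).

Definition flat (br : V -> V -> V) : Prop :=
  forall u v w x, curvature br u v w x = 0.

End MetricOperations.

End Algebra.

Section DoubleExtensionModel.
Variables (R : realType) (B : vectType R).
Variables (brB : {bilinear B -> B -> B}) (gB : {symmetric B}).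
Variables (D xi : 'End(B)) (b0 : B) (lambda : R).

(* The triple (a, u, c) stands for a d + u + c e. *)
Definition dext : vectType R := (R^o * B * R^o)%type.

Definition dext_d : dext := (1, 0, 0).
Definition dext_e : dext := (0, 0, 1).
Definition dext_in (u : B) : dext := (0, u, 0).

(* Antisymmetric bilinear extension of the defining brackets, which are
   recovered in [dext_bracket_de], [dext_bracket_du], [dext_bracket_eu] and
   [dext_bracket_uv]. *)
Definition dext_bracket (x y : dext) : dext :=
  let: (a, u, c) := x in let: (a', u', c') := y in
  (0,
   a *: D u' - a' *: D u + brB u u',
   lambda * (a * c' - a' * c) + a * gB b0 u' - a' * gB b0 u
     - gB (xi u - adjoint gB xi u) u').

Definition dext_form (x y : dext) : R :=
  let: (a, u, c) := x in let: (a', u', c') := y in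
  a * c' + c * a' + gB u u'.

Definition dext_levi_civita_table : Prop :=
  let L := levi_civita dext_form dext_bracket in
  let d := dext_d in let e := dext_e in let i := dext_in in
  [/\ [/\ L e e = 0, (forall u, L e (i u) = 0), (forall u, L (i u) e = 0)
        & L e d = 0],
      L d e = lambda *: e /\ L d d = - i b0 - lambda *: d,
      forall u, L d (i u) = i (D u + xi u) + gB b0 u *: e,
      forall u, L (i u) d = i (xi u)
    & forall u v,
        L (i u) (i v) = i (levi_civita gB brB u v) - gB (xi u) v *: e].

End DoubleExtensionModel.

Definition flat_double_extension (R : realType) (M B : vectType R)
    (br : {bilinear M -> M -> M}) (g : {symmetric M})
    (brB : {bilinear B -> B -> B}) (gB : {symmetric B})
    (D xi : 'End(B)) (b0 : B) (lambda : R) : Prop :=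
  [/\ pseudo_euclidean_malcev brB gB /\ flat gB brB,
      pseudo_euclidean_malcev br g /\ flat g br,
      exists phi : {linear M -> dext B},
        [/\ bijective phi,
            forall x y,
              phi (br x y) = dext_bracket brB gB D xi b0 lambda (phi x) (phi y)
          & forall x y, dext_form gB (phi x) (phi y) = g x y]
    & dext_levi_civita_table brB gB D xi b0 lambda].

Section Facts.
Variables (R : realType) (V : vectType R).

Lemma bracketvP (br : {bilinear V -> V -> V}) (U W X : {vspace V}) :
  (bracketv br U W <= X)%VS <-> {in U & W, forall u v, br u v \in X}.
Proof.
split=> [sX u v uU vW|H].
  rewrite (coord_vbasis uU) (coord_vbasis vW) linear_sumlz.
  apply: memv_suml => i _; rewrite linear_sumr; apply: memv_suml => j _.
  rewrite linearZl_LR linearZr_LR; do 2! apply: memvZ.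
  apply: (subvP sX); apply: memv_span; apply/allpairsP.
  by exists ((vbasis U)`_i, (vbasis W)`_j); rewrite /= !mem_nth ?size_tuple.
apply/span_subvP => _ /allpairsP[[u v] /= [/vbasis_mem uU /vbasis_mem vW ->]].
exact: H.
Qed.

Variable g : {symmetric V}.
Hypothesis g_nondeg : nondegenerate g.

Lemma nondegenerateP (x : V) : (forall w, g x w = 0) -> x = 0.
Proof.
move=> gx0; apply/eqP; rewrite -memv0 -(eqP g_nondeg).
by apply/mem_orthovP => w _; apply: gx0.
Qed.

Lemma rieszP (phi : {scalar V}) (w : V) : g (riesz g phi) w = phi w.
Proof.
suff : exists x, forall w, g x w = phi w.
  by move=> exx; apply: (xgetPex 0 (P := [set x | forall w, g x w = phi w])).
pose h (x : V) := \row_(i < \dim {:V}) (g x (vbasis {:V})`_i).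
have h_lin : linear h.
  move=> a x y; apply/rowP => i.
  by rewrite !mxE linearDl linearZl_LR.
pose H := linfun (HB.pack_for {linear V -> 'rV[R]_(\dim {:V})} h
  (GRing.isLinear.Build _ _ _ _ h h_lin)).
have HE x : H x = h x by rewrite lfunE.
have ker0 : lker H = 0%VS.
  apply/eqP; rewrite -subv0; apply/subvP => x; rewrite memv_ker HE => /eqP hx0.
  rewrite memv0; apply/eqP/nondegenerateP => v.
  rewrite (coord_vbasis (memvf v)) linear_sumr big1// => i _.
  rewrite linearZr_LR /=; have /rowP/(_ i) := hx0.
  by rewrite !mxE => ->; rewrite mulr0.
have limgT : limg H = fullv.
  apply/eqP; rewrite eqEdim subvf limg_dim_eq ?ker0 ?capv0//.
  by rewrite [X in (X <= _)%N]dimvf /dim /= mul1n.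
pose r := \row_(i < \dim {:V}) phi (vbasis {:V})`_i.
have /memv_imgP[x _ rx] : r \in limg H by rewrite limgT memvf.
exists x => v; rewrite (coord_vbasis (memvf v)) linear_sumr linear_sum.
apply: eq_bigr => i _; rewrite linearZr_LR linearZ /=; congr (_ * _).
by move/rowP/(_ i): rx; rewrite HE !mxE.
Qed.

Lemma riesz_unique (phi : V -> R) (x : V) :
  (forall w, g x w = phi w) -> riesz g phi = x.
Proof.
move=> xP; apply: xget_unique => // y yP.
apply/eqP; rewrite -subr_eq0; apply/eqP/nondegenerateP => w.
by rewrite linearBl /= xP yP subrr.
Qed.

Lemma adjointP (f : 'End(V)) (u v : V) : g (adjoint g f u) v = g u (f v).
Proof.
have lin : scalar (fun v => g u (f v)).
  by move=> a x y; rewrite !linearP.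
pose k : {scalar V} := HB.pack_for {scalar V} (fun v => g u (f v))
  (GRing.isLinear.Build _ _ _ _ (fun v => g u (f v)) lin).
exact: (rieszP k).
Qed.

Lemma levi_civitaP (br : {bilinear V -> V -> V}) (u v w : V) :
  2 * g (levi_civita g br u v) w
    = g (br u v) w - g (br v w) u + g (br w u) v.
Proof.
pose k w := 2^-1 * (g (br u v) w - g (br v w) u + g (br w u) v).
have lin : scalar k.
  move=> a x y; rewrite /k !(linearDl, linearDr, linearZl_LR, linearZr_LR) /=.
  by ring.
pose K : {scalar V} := HB.pack_for {scalar V} k
  (GRing.isLinear.Build _ _ _ _ k lin).
have -> : levi_civita g br u v = riesz g K by [].
by rewrite rieszP /= mulrA divff ?mul1r// pnatr_eq0.
Qed.

End Facts.

Section DoubleExtensionFacts.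
Variables (R : realType) (B : vectType R).
Variables (brB : {bilinear B -> B -> B}) (gB : {symmetric B}).
Variables (D xi : 'End(B)) (b0 : B) (lambda : R).
Hypothesis gB_nondeg : nondegenerate gB.

Local Notation brk := (dext_bracket brB gB D xi b0 lambda).
Local Notation d := (dext_d B).
Local Notation e := (dext_e B).
Local Notation i := (@dext_in R B).

Let adjoint0 : adjoint gB xi 0 = 0.
Proof. by apply: riesz_unique => // w; rewrite !linear0l. Qed.

Let simp := (adjoint0, linear0, linear0l, linear0r, scale0r, scaler0, scale1r,
  mul0r, mulr0, mul1r, mulr1, subr0, sub0r, oppr0, addr0, add0r).

Lemma dext_bracket_de : brk d e = lambda *: e.
Proof.
rewrite /dext_bracket /= !simp.
by congr (_, _, _); rewrite /= ?simp ?[_ *: _]mulr1.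
Qed.

Lemma dext_bracket_du u : brk d (i u) = i (D u) + gB b0 u *: e.
Proof.
rewrite /dext_bracket /= !simp.
by congr (_, _, _); rewrite /= ?simp ?[_ *: _]mulr1.
Qed.

Lemma dext_bracket_eu u : brk e (i u) = 0.
Proof. by rewrite /dext_bracket /= !simp. Qed.

Lemma dext_bracket_uv u v :
  brk (i u) (i v) = i (brB u v) - gB (xi u - adjoint gB xi u) v *: e.
Proof.
rewrite /dext_bracket /= !simp.
by congr (_, _, _); rewrite /= ?simp ?[_ *: _]mulr1.
Qed.

Lemma dext_bracket_antisym :
  antisymmetric_bracket brB -> forall x y, brk x y = - brk y x.
Proof.
move=> anti [[a u] c] [[a' u'] c'].
rewrite /dext_bracket; congr (_, _, _); rewrite /= ?oppr0//.
  by rewrite (anti u' u) !opprD !opprK; congr (_ + _); rewrite addrC.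
rewrite !linearBl /= !adjointP//.
have sym x y : gB x y = gB y x by rewrite hermitian_subproof expr0 mul1r.
rewrite (sym (xi u') u) (sym u' (xi u)).
by ring.
Qed.

End DoubleExtensionFacts.

(* Main.v *)
Require Import Defs.
From HB Require Import structures.
From mathcomp Require Import all_boot all_order all_algebra.
From mathcomp Require Import boolp classical_sets reals ring lra.

(** Call an element neutral if it multiplies to 0, on both sides, for the
    Levi-Civita product u.v. The proof finds a null vector e <> 0 that is
    neutral, and then studies e^perp modulo e, which is Euclidean.

    Existence of e. The Levi-Civita product is the only torsion-free product
    whose left multiplications L u are skew. If z is central, flatness says that
    L z commutes with every L v L u; evaluating at z gives L z L v L z = 0
    ([central_flat_triple0]). When the algebra is not abelian, take z <> 0 in the
    centre and in the derived algebra. Either L z = 0, and then z is orthogonal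
    to the derived algebra, hence null and neutral; or L z is a nonzero skew
    operator with cube 0, in Lorentzian signature its square is nonzero, and the
    image of that square is spanned by a null e with v.e = 0 for all v. Such an
    e is neutral by nilpotency ([null_parallel_neutral]).

    The quotient e^perp / e is abelian: it is Euclidean, flat and nilpotent, so
    the same identity gives (L z)^3 = 0, whence L z = 0, for z central in it
    ([perp_bracket_line]).

    The operator D. Choose a null d with <e,d> = 1 and, modulo e, put A x = d.x,
    xi x = x.d and D x = [d,x] = A x - xi x on e^perp. Two components of the
    flatness identity say that the defect T = A xi - xi D satisfies A T = 0 and
    <xi u, T w> = 0. As A is skew, <T w, T w> = - <xi w, A T w> - <xi D w, T w>
    is zero, so T = 0. Then A^n xi = xi D^n vanishes for large n, because ad d is
    nilpotent, and a skew operator of a Euclidean space that kills a vector after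
    n steps kills it at once: A xi = 0 = xi D. Now D^2 = A^2, so A is nilpotent
    and skew, that is A = 0 ([product_line]). Hence D = - xi and xi^2 = 0, and
    all double brackets lie on the line of e ([bracket_bracket_line]), which is
    central.

    The remaining part identifies the algebra with the double extension of the
    orthogonal complement of d and e by (- xi, xi, - d.d, 0), and checks the
    table of the Levi-Civita product of a double extension, which holds as soon
    as D + xi is skew ([dext_levi_civitaE]). *)

Set Implicit Arguments.
Unset Strict Implicit.
Unset Printing Implicit Defensive.

Import Order.TTheory GRing.Theory Num.Theory.

Local Open Scope ring_scope.

(** * Symmetric bilinear forms of Lorentzian signature *)

Section SymmetricForm.
Variables (R : realType) (V : vectType R) (g : {symmetric V}).
Implicit Types x y z : V.

Lemma symC x y : g x y = g y x.
Proof. by rewrite hermitian_subproof expr0 mul1r. Qed.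

Lemma symZl a x y : g (a *: x) y = a * g x y.
Proof. exact: linearZl_LR. Qed.

Lemma symZr a x y : g x (a *: y) = a * g x y.
Proof. exact: linearZr_LR. Qed.

Lemma symDl x y z : g (x + y) z = g x z + g y z.
Proof. exact: linearDl. Qed.

Lemma symDr x y z : g x (y + z) = g x y + g x z.
Proof. exact: linearDr. Qed.

Lemma symBl x y z : g (x - y) z = g x z - g y z.
Proof. exact: linearBl. Qed.

Lemma symBr x y z : g x (y - z) = g x y - g x z.
Proof. exact: linearBr. Qed.

Lemma symNl x y : g (- x) y = - g x y.
Proof. exact: linearNl. Qed.

Lemma symNr x y : g x (- y) = - g x y.
Proof. exact: linearNr. Qed.

Lemma sym0l x : g 0 x = 0.
Proof. exact: linear0l. Qed.

Lemma sym0r x : g x 0 = 0.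
Proof. exact: linear0r. Qed.

Definition symE :=
  (symDl, symDr, symBl, symBr, symNl, symNr, sym0l, sym0r, symZl, symZr).

End SymmetricForm.

(** All that is used of the Lorentzian signature is a vector t whose orthogonal
    complement is positive definite. *)
Section LorentzForm.
Variables (R : realType) (V : vectType R) (g : {symmetric V}) (t : V).
Hypothesis t_pos : forall x, g t x = 0 -> x != 0 -> 0 < g x x.
Implicit Types x y e : V.

(** Moving x along e until it becomes orthogonal to t changes neither its
    square nor its class modulo e, and t^perp is definite. *)
Lemma lorentz_perp_pos e x :
  e != 0 -> g e e = 0 -> g e x = 0 -> x \notin <[e]>%VS -> 0 < g x x.
Proof.
move=> e0 ee ex xe.
have te : g t e != 0.
  by apply/eqP => te; have := t_pos te e0; rewrite ee ltxx.
pose c := g t x / g t e; pose y := x - c *: e.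
have ty : g t y = 0. by rewrite /y !symE divfK// subrr.
have y0 : y != 0.
  apply: contraNneq xe => /eqP; rewrite subr_eq0 => /eqP->.
  by apply/vlineP; exists c.
have := t_pos ty y0; rewrite /y !symE ee (symC g x e) ex.
by rewrite !(mulr0, subr0, oppr0, addr0).
Qed.

Lemma lorentz_null_line e x :
  e != 0 -> g e e = 0 -> g e x = 0 -> g x x = 0 -> x \in <[e]>%VS.
Proof.
move=> e0 ee ex xx; apply/negP => /negP xe.
by have := lorentz_perp_pos e0 ee ex xe; rewrite xx ltxx.
Qed.

(** If N^2 = 0 and N is skew, then the image of N is totally isotropic, hence a
    line; but a skew operator has even rank. *)
Lemma lorentz_skew_sqr0 (N : V -> V) :
  nondegenerate g -> (forall x y, g (N x) y = - g x (N y)) ->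
  (forall x, N (N x) = 0) -> forall x, N x = 0.
Proof.
move=> nd skew NN x; apply/eqP/negP => /negP f0.
have isot y z : g (N y) (N z) = 0 by rewrite skew NN !symE oppr0.
case: (pselect (exists v, g (N x) v != 0)) => [[v fv]|no]; last first.
  case/eqP: f0; apply: (nondegenerateP nd) => w.
  by apply/eqP/negP => /negP fw; apply: no; exists w.
have [c Nv] := vlineP _ _ (lorentz_null_line f0 (isot x x) (isot x v) (isot v v)).
have vv : g (N v) v = 0 by have := skew v v; rewrite (symC g v); lra.
have c0 : c = 0.
  by apply/eqP; move/eqP: vv; rewrite Nv symE mulf_eq0 (negPf fv) orbF.
by move: fv; rewrite skew Nv c0 scale0r !symE oppr0 eqxx.
Qed.

End LorentzForm.

Lemma lorentz_signature (R : realType) (V : vectType R) (g : {symmetric V}) n :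
  (0 < n)%N -> has_signature g 1 n ->
  exists t f : V, [/\ (forall x, g t x = 0 -> x != 0 -> 0 < g x x),
    f != 0 & g f f = 0].
Proof.
case: n => // n _ [e [eb eP]].
have tt : g e`_0 e`_0 = -1 by have := eP ord0 ord0; rewrite eqxx.
have ff : g e`_1 e`_1 = 1.
  by have := eP (Ordinal (isT : 1 < 1 + n.+1)%N) (Ordinal (isT : 1 < 1 + n.+1)%N);
     rewrite eqxx.
have tf : g e`_0 e`_1 = 0 by have := eP ord0 (Ordinal (isT : 1 < 1 + n.+1)%N).
exists e`_0, (e`_0 + e`_1); split => //; last 2 first.
- apply/eqP => /(congr1 (g e`_0)); rewrite !symE tt tf => /eqP.
  by rewrite addr0 oppr_eq0 oner_eq0.
- by rewrite !symE (symC g e`_1) tt tf ff; ring.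
move=> x tx x0.
have xE := coord_basis eb (memvf x).
have ge (i : 'I_(1 + n.+1)) : g e`_i x =
    (if (i < 1)%N then -1 else 1) * coord e i x.
  rewrite [in LHS]xE linear_sumr (bigD1 i)//= symZr eP eqxx big1 ?addr0 1?mulrC//.
  by move=> j ji; rewrite symZr eP eq_sym (negPf ji) mulr0.
have c0 : coord e ord0 x = 0 by have := ge ord0; rewrite tx /=; lra.
have gxx : g x x = \sum_i coord e i x ^+ 2.
  rewrite [in g x x]xE linear_sumlz; apply: eq_bigr => i _.
  rewrite /= symZl -xE ge; case: (posnP i) => [i0|ip].
    by have -> : i = ord0 by [apply/val_inj]; rewrite c0 mul0r expr0n.
  by rewrite ltnNge ip /= mul1r expr2.
rewrite lt_neqAle gxx sumr_ge0 ?andbT => [|i _]; last exact: sqr_ge0.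
rewrite eq_sym psumr_neq0 => [|i _]; last exact: sqr_ge0.
apply/hasPn => no; case/eqP: x0; rewrite xE big1// => i _.
have := no i; rewrite mem_index_enum /= lt_neqAle sqr_ge0 andbT negbK eq_sym.
by rewrite sqrf_eq0 => /(_ isT)/eqP->; rewrite scale0r.
Qed.

(** * Nilpotent algebras *)

Section Nilpotent.
Variables (R : realType) (V : vectType R) (br : {bilinear V -> V -> V}).
Implicit Types (u v x y e : V) (H P U : {vspace V}).

Lemma mem_bracketv U H u v : u \in U -> v \in H -> br u v \in bracketv br U H.
Proof. by move=> uU vH; exact: (bracketvP br U H _).1 (subvv _) u v uU vH. Qed.

Lemma bracketvS U U' H H' :
  (U <= U')%VS -> (H <= H')%VS -> (bracketv br U H <= bracketv br U' H')%VS.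
Proof.
move=> /subvP sU /subvP sH; apply/bracketvP => u v uU vH.
by apply: mem_bracketv; [exact: sU | exact: sH].
Qed.

Lemma bracket_iter_lower_central (a : R) y n x :
  iter n (fun x => a *: br x y) x \in lower_central br n.
Proof.
elim: n => [|n IH]; first exact: memvf.
by rewrite iterS; apply: memvZ; apply: mem_bracketv; rewrite ?memvf.
Qed.

Hypothesis nil : nilpotent_algebra br.

Lemma bracket_nilpotent (a : R) y :
  exists n, forall x, iter n (fun x => a *: br x y) x = 0.
Proof.
have [n n0] := nil; exists n => x; apply/eqP; rewrite -memv0 -n0.
exact: bracket_iter_lower_central.
Qed.

Lemma nilpotent_no_eigenvector (a : R) e y : br e y = a *: e -> a != 0 -> e = 0.
Proof.
move=> eE a0; have [n n0] := nil; apply/eqP; rewrite -memv0 -n0.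
suff -> : e = iter n (fun x => a^-1 *: br x y) e.
  exact: bracket_iter_lower_central.
by elim: n {n0} => //= n <-; rewrite eE scalerA mulVf// scale1r.
Qed.

(** Some term of the series [H,H], [[H,H],H], ... is not inside P while the next
    one is; z is taken in the former. With P = 0 and H the whole algebra, z is
    a central element of the derived algebra. *)
Lemma last_bracket H P :
  (bracketv br H H <= H)%VS -> ~~ (bracketv br H H <= P)%VS ->
  exists z, [/\ z \in bracketv br H H, z \notin P
    & forall h, h \in H -> br z h \in P].
Proof.
move=> HH HP; pose C k := iter k (fun U => bracketv br U H) (bracketv br H H).
have C0 k : (C k <= bracketv br H H)%VS.
  elim: k => [|k IH]; first exact: subvv.
  by rewrite /C iterS bracketvS// (subv_trans IH).
have Clc k : (C k <= lower_central br k.+1)%VS.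
  elim: k => [|k IH]; first by rewrite bracketvS// subvf.
  by rewrite /C iterS [X in (_ <= X)%VS]iterS bracketvS// subvf.
have exk : exists k, (C k <= P)%VS.
  have [n n0] := nil; exists n; apply: subv_trans (Clc n) _.
  rewrite /lower_central iterS -/(lower_central br n) n0.
  by apply/bracketvP => u v; rewrite memv0 => /eqP->; rewrite linear0l mem0v.
case: (ex_minnP exk) => -[|k] kP kmin; first by rewrite /C /= in kP; rewrite kP in HP.
have /subvPn[z zC zP] : ~~ (C k <= P)%VS.
  by apply/negP => /kmin; rewrite ltnn.
exists z; split=> // [|h hH]; first exact: (subvP (C0 k)).
by apply: (subvP kP); rewrite /C iterS; apply: mem_bracketv.
Qed.

End Nilpotent.

Lemma nilpotent_fun_ker_im (V : nmodType) (N : V -> V) n x :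
  iter n N x = 0 -> N 0 = 0 -> N x <> 0 -> exists y, N y <> 0 /\ N (N y) = 0.
Proof.
move=> Nn N0; elim: n x Nn => [|n IH] x /=; first by move=> -> /(_ N0).
move=> Nnx Nx; case: (pselect (N (N x) = 0)) => [|NNx]; first by exists x.
by apply: (IH (N x)); rewrite -?iterSr.
Qed.

(** * Flat torsion-free metric products *)

Section FlatProduct.
Variables (R : realType) (V : vectType R) (g : {symmetric V}).
Variables br L : {bilinear V -> V -> V}.
Hypothesis nd : nondegenerate g.
Hypothesis skew : forall u v w, g (L u v) w = - g v (L u w).
Hypothesis torsion : forall u v, L u v - L v u = br u v.
Hypothesis flatL : forall u v w x,
  L (br (br u v) w) x - L (br u w) (L v x) - L u (L (br v w) x)
  + L v (L u (L w x)) - L w (L v (L u x)) = 0.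
Implicit Types u v w x y z e : V.

Lemma product_swap u v : L u v = L v u + br u v.
Proof. by rewrite -torsion addrC subrK. Qed.

Lemma bracketC u v : br u v = - br v u.
Proof. by rewrite -!torsion opprB. Qed.

Lemma bracketxx u : br u u = 0.
Proof. by rewrite -torsion subrr. Qed.

Lemma skew0 u v : g (L u v) v = 0.
Proof. by have := skew u v v; rewrite (symC g v); lra. Qed.

Lemma koszul u v w :
  2 * g (L u v) w = g (br u v) w - g (br v w) u + g (br w u) v.
Proof.
rewrite -!torsion !symE (skew v w) (skew w u) (skew u w).
by rewrite (symC g u (L w v)) (symC g w (L v u)) (symC g w (L u v)); ring.
Qed.

Lemma bracket_left_nilpotent :
  nilpotent_algebra br -> forall y, exists n, forall x, iter n (br y) x = 0.
Proof.
move=> nil y; have [n n0] := bracket_nilpotent nil (-1) y.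
exists n => x; rewrite -[RHS](n0 x).
by apply: eq_iter => z; rewrite scaleN1r -bracketC.
Qed.

Definition neutral x := (forall v, L x v = 0) /\ (forall v, L v x = 0).

Lemma neutral_line e x : neutral e -> x \in <[e]>%VS -> neutral x.
Proof.
move=> [eL eR] /vlineP[c ->].
by split=> v; rewrite ?linearZl_LR ?linearZr_LR /= ?eL ?eR scaler0.
Qed.

Lemma neutral_bracket e v : neutral e -> br e v = 0.
Proof. by move=> [eL eR]; rewrite -torsion eL eR subrr. Qed.

Section CentralModuloNeutral.
Variables (H : {vspace V}) (z : V).
Hypothesis zH : forall h, h \in H -> neutral (br z h).
Hypothesis HH : {in H &, forall u v, br u v \in H}.

Lemma central_flat_comm u v x :
  u \in H -> v \in H -> L z (L v (L u x)) = L v (L u (L z x)).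
Proof.
move=> uH vH; have := flatL u v z x.
have bz h : h \in H -> neutral (br h z).
  move=> hH; rewrite bracketC; have [zL zR] := zH hH.
  by split=> w; rewrite ?linearNl ?linearNr /= ?zL ?zR oppr0.
rewrite (bz _ (HH uH vH)).1 (bz _ uH).1 (bz _ vH).1 linear0r !subr0 add0r.
by move/eqP; rewrite subr_eq0 => /eqP->.
Qed.

(** The flatness identity makes L z commute with L v L u; evaluated at z this
    gives L z (L v (L u z)) = 0, and L u z is L z u up to a neutral vector. *)
Lemma central_flat_triple0 u v :
  neutral (L z z) -> u \in H -> v \in H -> L z (L v (L z u)) = 0.
Proof.
move=> zz uH vH; rewrite (product_swap z u) linearDr (zH uH).2 addr0.
by rewrite central_flat_comm// zz.2 linear0r.
Qed.

End CentralModuloNeutral.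

Section NullNeutral.
Variable t : V.
Hypothesis t_pos : forall x, g t x = 0 -> x != 0 -> 0 < g x x.
Hypothesis nil : nilpotent_algebra br.

(** Since L v e = 0, the operators L e and ad e agree, so L e is skew and
    nilpotent. If it were nonzero, its image would meet its kernel in a null
    vector orthogonal to e, hence proportional to e; then e = [e, y] up to a
    scalar, contradicting nilpotency. *)
Lemma null_parallel_neutral e :
  e != 0 -> g e e = 0 -> (forall v, L v e = 0) -> neutral e.
Proof.
move=> e0 ee Le; split=> // v; apply: contrapT => Lev.
have adL x : br e x = L e x by rewrite -torsion Le subr0.
have [n Nn] := bracket_left_nilpotent nil e.
have [y [Ly LLy]] : exists y, L e y <> 0 /\ L e (L e y) = 0.
  apply: (nilpotent_fun_ker_im _ (linear0r _ _) Lev).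
  by rewrite -(eq_iter adL); exact: Nn.
have ff : g (L e y) (L e y) = 0 by rewrite skew LLy sym0r oppr0.
have ef : g e (L e y) = 0 by rewrite symC skew Le sym0r oppr0.
have /vlineP[c Lc] := lorentz_null_line t_pos e0 ee ef ff.
have c0 : c != 0 by apply: contra_notN Ly => /eqP c0; rewrite Lc c0 scale0r.
have eE : br e y = c *: e by rewrite adL.
by move/eqP: (nilpotent_no_eigenvector nil eE c0); apply/negP.
Qed.

(** If the algebra is abelian, the product vanishes and any null vector will do.
    Otherwise take a nonzero central z in [V,V]. If L z = 0 then z is
    orthogonal to [V,V], hence null. If not, L z is skew with cube zero, so its
    square is nonzero and has a null image, and L v (L z (L z u)) = 0. *)
Lemma null_neutral_exists f :
  f != 0 -> g f f = 0 -> exists e, [/\ e != 0, g e e = 0 & neutral e].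
Proof.
move=> f0 ff.
have [ab|] := boolP (bracketv br fullv fullv <= 0)%VS.
  exists f; suff L0 u v : L u v = 0 by split; rewrite // /neutral; split.
  have ab0 x y : br x y = 0.
    by apply/eqP; rewrite -memv0; apply: (bracketvP br _ _ _).1 ab _ _ _ _;
       rewrite memvf.
  apply: (nondegenerateP nd) => w; have := koszul u v w.
  by rewrite !ab0 !symE; lra.
move=> /(last_bracket nil (subvf _))[z [zVV z0 zC]].
have z_central v : br z v = 0 by apply/eqP; rewrite -memv0 zC ?memvf.
have z_central' v : br v z = 0 by rewrite bracketC z_central oppr0.
rewrite memv0 in z0.
have Lz v w : g (L z v) w = - 2^-1 * g (br v w) z.
  by have := koszul z v w; rewrite z_central z_central' !symE; lra.
have neutral0 : neutral 0 by split=> v; rewrite ?linear0l ?linear0r.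
have Lzz : L z z = 0.
  by apply: (nondegenerateP nd) => w; rewrite Lz z_central sym0l mulr0.
have LzC u v x : L z (L v (L u x)) = L v (L u (L z x)).
  apply: (central_flat_comm (H := fullv)); rewrite ?memvf//.
    by move=> h _; rewrite z_central.
  by move=> ? ? _ _; exact: memvf.
have Lz3 u v : L z (L v (L z u)) = 0.
  apply: (central_flat_triple0 (H := fullv)); rewrite ?memvf ?Lzz//.
    by move=> h _; rewrite z_central.
  by move=> ? ? _ _; exact: memvf.
have [Lz0|/existsNP[u uN]] := pselect (forall v, L z (L z v) = 0).
  have {}Lz0 := lorentz_skew_sqr0 t_pos nd (skew z) Lz0.
  exists z; split=> //; last by split=> // v; rewrite product_swap Lz0 z_central' addr0.
  have /mem_orthovP : z \in orthov g (bracketv br fullv fullv).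
    rewrite mem_orthov_sym; apply/bracketvP => v w _ _.
    by rewrite mem_orthov1; have := Lz v w; rewrite Lz0 sym0l => zvw; apply/eqP; lra.
  exact.
have par v : L v (L z (L z u)) = 0 by rewrite -LzC Lz3.
have eN0 : L z (L z u) != 0 by apply/eqP.
have eNull : g (L z (L z u)) (L z (L z u)) = 0 by rewrite skew par sym0r oppr0.
by exists (L z (L z u)); split=> //; apply: null_parallel_neutral.
Qed.

End NullNeutral.

Section NullReduction.
Variables (t e : V).
Hypothesis t_pos : forall x, g t x = 0 -> x != 0 -> 0 < g x x.
Hypothesis nil : nilpotent_algebra br.
Hypotheses (e0 : e != 0) (ee : g e e = 0) (e_neutral : neutral e).

Lemma product_perp u v : g e (L u v) = 0.
Proof. by apply: oppr_inj; rewrite oppr0 -skew e_neutral.2 sym0l. Qed.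

Lemma bracket_perp u v : g e (br u v) = 0.
Proof. by rewrite -torsion symBr !product_perp subrr. Qed.

Lemma line_perp x y : x \in <[e]>%VS -> g e y = 0 -> g x y = 0.
Proof. by move=> /vlineP[c ->] ey; rewrite symZl ey mulr0. Qed.

Lemma product_liner x y : y \in <[e]>%VS -> L x y = 0.
Proof. by move=> /(neutral_line e_neutral)[]. Qed.

Lemma product_linel x y : x \in <[e]>%VS -> L x y = 0.
Proof. by move=> /(neutral_line e_neutral)[]. Qed.

Lemma bracket_linel x y : x \in <[e]>%VS -> br x y = 0.
Proof. by move=> /(neutral_line e_neutral)/neutral_bracket. Qed.

Lemma null_line x : g e x = 0 -> g x x = 0 -> x \in <[e]>%VS.
Proof. exact: (lorentz_null_line t_pos). Qed.

(** The quotient of e^perp by e is flat, nilpotent and Euclidean, and such an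
    algebra is abelian: a central z in the derived algebra has (L z)^3 = 0, but
    a skew operator of a definite form is not nilpotent unless it is 0, so z is
    orthogonal to the derived algebra and to itself. *)
Lemma perp_bracket_line u v : g e u = 0 -> g e v = 0 -> br u v \in <[e]>%VS.
Proof.
pose H := orthov g <[e]>.
have HP x : (x \in H) = (g e x == 0) by rewrite mem_orthov1 symC.
move=> /eqP; rewrite -HP => uH /eqP; rewrite -HP => vH.
have HH : {in H &, forall x y, br x y \in H}.
  by move=> x y _ _; rewrite HP bracket_perp.
suff : (bracketv br H H <= <[e]>)%VS by move=> /(bracketvP br _ _ _).1; apply.
apply: contraT => /(last_bracket nil ((bracketvP br _ _ _).2 HH))[z [zHH zNe zC]].
have zH : z \in H by apply: (subvP ((bracketvP br _ _ _).2 HH)).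
have ez : g e z = 0 by apply/eqP; rewrite -HP.
have zCr h : h \in H -> br h z \in <[e]>%VS.
  by move=> hH; rewrite bracketC memvN zC.
have Lz x y : x \in H -> y \in H -> 2 * g (L z x) y = - g (br x y) z.
  move=> xH yH; have := koszul z x y.
  rewrite (line_perp (zC x xH)) ?(line_perp (zCr y yH)) ?sub0r ?addr0//;
    by apply/eqP; rewrite -HP.
have LH x y : L x y \in H by rewrite HP product_perp.
have Lzz : L z z \in <[e]>%VS.
  apply: null_line; rewrite ?product_perp//.
  by have := Lz z (L z z) zH (LH _ _); rewrite (line_perp (zC _ (LH _ _)) ez); lra.
have Lz3 x : x \in H -> L z (L z (L z x)) = 0.
  move=> xH; apply: (central_flat_triple0 (H := H)) => // [h /zC|].
    exact: neutral_line.
  exact: neutral_line Lzz.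
have Lz2 x : x \in H -> L z (L z x) \in <[e]>%VS.
  move=> xH; apply: null_line; rewrite ?product_perp//.
  by rewrite skew Lz3 ?sym0r ?oppr0.
have Lz1 x : x \in H -> L z x \in <[e]>%VS.
  move=> xH; apply: null_line; rewrite ?product_perp//.
  rewrite skew symC (line_perp (Lz2 x xH)) ?oppr0//.
  by apply/eqP; rewrite -HP.
have zz : z \in orthov g (bracketv br H H).
  rewrite mem_orthov_sym; apply/bracketvP => x y xH yH.
  rewrite mem_orthov1; have := Lz x y xH yH; rewrite (line_perp (Lz1 x xH)).
    by move=> xyz; apply/eqP; lra.
  by apply/eqP; rewrite -HP.
by case/negP: zNe; apply: null_line => //; move/mem_orthovP: zz; apply.
Qed.

Lemma perp_product_line u v : g e u = 0 -> g e v = 0 -> L u v \in <[e]>%VS.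
Proof.
move=> eu ev; apply: null_line; rewrite ?product_perp//.
have := koszul u v (L u v).
by rewrite !(line_perp (perp_bracket_line _ _)) ?product_perp//; lra.
Qed.

Variable d : V.
Hypothesis ed : g e d = 1.

(** Up to the line of e, this is T = A xi - xi D, with A = L d, xi = L _ d and
    D = ad d acting on e^perp. *)
Definition defect w := L d (L w d) - L (br d w) d.

Lemma defect_perp w : g e (defect w) = 0.
Proof. by rewrite symBr !product_perp subrr. Qed.

(** Modulo e, this is K(d,d,w)d = 0: since [d,d] = 0, the other terms of K are
    products of two elements of e^perp. *)
Lemma product_defect_line w : g e w = 0 -> L d (defect w) \in <[e]>%VS.
Proof.
move=> ew; have := flatL d d w d.
rewrite bracketxx linear0l linear0l sub0r linearBr => /eqP.
set a := L _ _; set b := L d _; set c := L d _; set f := L w _ => abcf.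
have -> : c - b = a + f.
  apply/eqP; rewrite -subr_eq0 -(eqP abcf) opprD !addrA.
  by apply/eqP; congr (_ - _); rewrite addrC addrA addrAC.
by apply: memvD; apply: perp_product_line; rewrite ?product_perp ?bracket_perp.
Qed.

(** Every term of K(u,d,w)d lies on the line of e; pair it with d. *)
Lemma defect_ortho u w : g e u = 0 -> g e w = 0 -> g (L u d) (defect w) = 0.
Proof.
move=> eu ew; have := congr1 (g ^~ d) (flatL u d w d).
rewrite /= (product_linel _ (perp_bracket_line _ _)) ?bracket_perp//.
rewrite (product_linel _ (perp_bracket_line eu ew)).
rewrite (product_liner d (perp_product_line _ _)) ?product_perp//.
rewrite /defect !symE (skew u) (skew w) (skew d).
by rewrite (symC g (L (br d w) d)); lra.
Qed.

(** The defect is orthogonal to its part xi D, and pairing it with A xi gives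
    0 because A is skew and kills it: it is null in e^perp. *)
Lemma defect_line w : g e w = 0 -> defect w \in <[e]>%VS.
Proof.
move=> ew; apply: null_line; rewrite ?defect_perp//.
rewrite {1}/defect symBl defect_ortho ?bracket_perp// skew symC.
by rewrite (line_perp (product_defect_line ew)) ?product_perp// !oppr0 addr0.
Qed.

(** A is skew for the form of e^perp, which is definite modulo e, so its kernel
    does not grow under iteration. *)
Lemma product_nilpotent_line n x :
  g e x = 0 -> iter n (L d) x \in <[e]>%VS -> L d x \in <[e]>%VS.
Proof.
move=> ex; elim: n => [|[|n] IH] //=.
  by move=> /(product_liner d) ->; rewrite mem0v.
move=> An; apply: IH; rewrite iterS; apply: null_line; first exact: product_perp.
rewrite skew symC (line_perp An) ?oppr0//.
by case: n {An} => // n; rewrite iterS product_perp.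
Qed.

Lemma iter_bracket_perp n w : g e w = 0 -> g e (iter n (br d) w) = 0.
Proof. by case: n => // n; rewrite iterS bracket_perp. Qed.

(** As the defect vanishes modulo e, A^n xi = xi D^n there, and D is nilpotent. *)
Lemma product_right_line w : g e w = 0 -> L d (L w d) \in <[e]>%VS.
Proof.
move=> ew.
have comm n : iter n (L d) (L w d) - L (iter n (br d) w) d \in <[e]>%VS.
  elim: n => [|n IH]; first by rewrite /= subrr mem0v.
  rewrite !iterS; have /eqP := product_liner d IH.
  rewrite linearBr subr_eq0 => /eqP->.
  exact/defect_line/iter_bracket_perp.
have [n n0] := bracket_left_nilpotent nil d.
apply: (@product_nilpotent_line n); first exact: product_perp.
by have := comm n; rewrite n0 linear0l subr0.
Qed.

(** Modulo e this is A xi = xi D; it holds exactly because (D w).d is orthogonal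
    to d and e is not. *)
Lemma bracket_product_right w : g e w = 0 -> L (br d w) d = 0.
Proof.
move=> ew; have : L (br d w) d \in <[e]>%VS.
  rewrite -[L _ _](subKr (L d (L w d))).
  by apply: memvB; [exact: product_right_line | exact: defect_line].
move=> /vlineP[c cE]; have := skew0 (br d w) d.
by rewrite cE symZl ed mulr1 => ->; rewrite scale0r.
Qed.

(** A xi and xi D vanish modulo e, so the squares of D = A - xi and of A agree:
    A inherits nilpotency from D. *)
Lemma product_line w : g e w = 0 -> L d w \in <[e]>%VS.
Proof.
move=> ew.
have sqr x : g e x = 0 -> br d (br d x) - L d (L d x) \in <[e]>%VS.
  move=> ex; rewrite -(torsion d (br d x)) bracket_product_right// subr0.
  by rewrite -torsion linearBr addrAC subrr sub0r memvN product_right_line.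
have sqrn n : iter n.*2 (br d) w - iter n.*2 (L d) w \in <[e]>%VS.
  elim: n => [|n IH]; first by rewrite /= subrr mem0v.
  rewrite doubleS !iterS; have /eqP := product_liner d IH.
  rewrite linearBr subr_eq0 => /eqP <-.
  exact/sqr/iter_bracket_perp.
have [n n0] := bracket_left_nilpotent nil d.
apply: (@product_nilpotent_line n.*2) => //; rewrite -memvN -sub0r.
by rewrite -(n0 (iter n (br d) w)) -iterD addnn.
Qed.

Lemma product_right_sqr0 w : g e w = 0 -> L (L w d) d = 0.
Proof.
move=> ew; have -> : L w d = L d w - br d w by rewrite -torsion subKr.
by rewrite linearBl (product_linel _ (product_line ew)) bracket_product_right ?subrr.
Qed.

Lemma bracket_bracket_d_line w : g e w = 0 -> br d (br d w) \in <[e]>%VS.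
Proof.
move=> ew; rewrite -torsion bracket_product_right// subr0.
by rewrite product_line ?bracket_perp.
Qed.

(** Modulo e, e^perp is abelian, so every bracket is [d, x] with x in e^perp and
    only [[d, x], d] could leave the line of e; but D^2 = 0. *)
Lemma bracket_bracket_line u v w : br (br u v) w \in <[e]>%VS.
Proof.
have split x : exists a h, x = a *: d + h /\ g e h = 0.
  exists (g e x), (x - g e x *: d); rewrite addrC subrK; split=> //.
  by rewrite !symE ed mulr1 subrr.
have [[a [h [-> eh]]] [b [k [-> ek]]]] := (split u, split v).
have [c [l [-> el]]] := split w.
pose x := a *: k - b *: h.
have ex : g e x = 0 by rewrite !symE eh ek !mulr0 subrr.
have uvE : br (a *: d + h) (b *: d + k) - br d x \in <[e]>%VS.
  rewrite !linearDl !linearDr /= linearNr.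
  rewrite !linearZl_LR !linearZr_LR /= bracketxx !scaler0 add0r (bracketC h d).
  rewrite scalerN opprD opprK [_ + br h k]addrC addrA -addrA.
  suff -> : a *: br d k + (br h k - b *: br d h) +
      (- (a *: br d k) + b *: br d h) = br h k by exact: perp_bracket_line.
  by rewrite addrACA subrr add0r subrK.
have /eqP := bracket_linel (c *: d + l) uvE; rewrite linearBl subr_eq0 => /eqP->.
rewrite linearDr linearZr_LR /=; apply: memvD; last first.
  by rewrite perp_bracket_line ?bracket_perp.
by rewrite bracketC scalerN memvN memvZ ?bracket_bracket_d_line.
Qed.

End NullReduction.

End FlatProduct.

(** * The Levi-Civita product of a double extension *)

Section DextLeviCivita.
Variables (R : realType) (B : vectType R).
Variables (brB : {bilinear B -> B -> B}) (gB : {symmetric B}).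
Variables (D xi : 'End(B)) (b0 : B) (lambda : R).
Hypothesis nd : nondegenerate gB.
Hypothesis anti : antisymmetric_bracket brB.
Hypothesis skewDxi : forall u v, gB (D u + xi u) v = - gB u (D v + xi v).

Lemma dext_form_inj (x y : dext B) :
  (forall w, dext_form gB x w = dext_form gB y w) -> x = y.
Proof.
case: x y => [[a u] c] [[a' u'] c'] xy.
have := xy (dext_e B); have := xy (dext_d B).
rewrite /dext_form /= !sym0r !(mulr0, mulr1, addr0, add0r) => -> ->.
congr (_, _, _); apply/eqP; rewrite -subr_eq0; apply/eqP.
apply: (nondegenerateP nd) => w; have := xy (dext_in w).
by rewrite /dext_form /= !mulr0 !add0r symBl => ->; rewrite subrr.
Qed.

(** The bilinear extension of the expected table: the Koszul identity is then
    checked once instead of entry by entry. *)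
Definition dext_levi_civita (x y : dext B) : dext B :=
  let: (a, u, c) := x in let: (a', u', c') := y in
  (- (lambda * (a * a')),
   a *: (D u' + xi u') + a' *: xi u - (a * a') *: b0 + levi_civita gB brB u u',
   lambda * (a * c') + a * gB b0 u' - gB (xi u) u').

(** The candidate satisfies the Koszul identity against every vector, and the
    form separates points; the coefficients of D and xi match exactly because
    D + xi is skew. *)
Lemma dext_levi_civitaE x y :
  levi_civita (dext_form gB) (dext_bracket brB gB D xi b0 lambda) x y
    = dext_levi_civita x y.
Proof.
case: x y => [[a u] c] [[a' u'] c']; rewrite /levi_civita /riesz; set Q := (X in xget 0 X).
suff QL : Q (dext_levi_civita (a, u, c) (a', u', c')).
  apply: xget_unique => // z zQ; apply: dext_form_inj => w.
  by rewrite zQ QL.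
move=> [[a2 v] c2]; rewrite -[LHS](@mulKf _ 2) ?pnatr_eq0//; congr (_ * _).
rewrite /dext_levi_civita /dext_form /dext_bracket /= !symE !adjointP//.
have Dsub p q : gB (D p) q = - gB (xi p) q - gB (D q) p - gB (xi q) p.
  have := skewDxi p q.
  by rewrite !symE (symC gB p (D q)) (symC gB p (xi q)); lra.
rewrite !mulrDr (levi_civitaP nd brB u u' v).
rewrite (Dsub u' v) (Dsub u v) (Dsub u u').
rewrite (symC gB u (xi u')) (symC gB u' (xi v)) (symC gB v (xi u)).
by ring.
Qed.

Lemma dext_levi_civita_tableP : dext_levi_civita_table brB gB D xi b0 lambda.
Proof.
have L0r u : levi_civita gB brB u 0 = 0.
  apply: riesz_unique => // w.
  by rewrite !(linear0l, linear0r, sym0l, sym0r) /= !(subr0, addr0, mulr0).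
have L0l u : levi_civita gB brB 0 u = 0.
  apply: riesz_unique => // w.
  by rewrite !(linear0l, linear0r, sym0l, sym0r) /= !(subr0, addr0, mulr0).
have simp := (L0r, L0l, linear0, sym0l, sym0r, scale0r, scaler0, scale1r, mul0r,
  mulr0, mul1r, mulr1, oppr0, addr0, add0r, subr0).
split=> [||u|u|u v]; [split=> [|u|u|]|split|..];
  rewrite dext_levi_civitaE /dext_levi_civita /=; congr (_, _, _);
  by rewrite /= ?simp // ?[_ *: _]mulr1 ?[_ *: _]mulr0 ?simp.
Qed.

End DextLeviCivita.

(** * The zero bracket and restricted forms *)

Section ZeroBracket.
Variables (R : realType) (V : vectType R).

Definition zero_bracket (u v : V) : V := 0.

Lemma zero_bracket_bilinear : bilinear_for
  (GRing.Scale.Law.clone _ _ *:%R _) (GRing.Scale.Law.clone _ _ *:%R _)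
  zero_bracket.
Proof. by split=> u a x y; rewrite /= /zero_bracket scaler0 addr0. Qed.

HB.instance Definition _ :=
  bilinear_isBilinear.Build R V V V _ _ zero_bracket zero_bracket_bilinear.

Definition abelian_structure : {bilinear V -> V -> V} := zero_bracket.

Variable g : {symmetric V}.

Lemma positive_nondegenerate : positive_definite g -> nondegenerate g.
Proof.
move=> pos; rewrite /nondegenerate -subv0; apply/subvP => x.
move=> /mem_orthovP/(_ x (memvf x)) xx; rewrite memv0.
by apply: contraT => /pos; rewrite xx ltxx.
Qed.

Lemma zero_bracket_malcev : malcev_algebra abelian_structure.
Proof.
by split=> u v *; rewrite /jacobiator /= /zero_bracket ?oppr0 ?addr0.
Qed.

Lemma zero_bracket_lie : lie_algebra abelian_structure.
Proof.
by split=> u v *; rewrite /jacobiator /= /zero_bracket ?oppr0 ?addr0.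
Qed.

Lemma zero_bracket_flat : nondegenerate g -> flat g abelian_structure.
Proof.
move=> nd u v w x; rewrite /curvature.
have L0 y z : levi_civita g abelian_structure y z = 0.
  by apply: riesz_unique => // s; rewrite !sym0l !(subr0, addr0, mulr0).
by rewrite !L0 !subr0 addr0.
Qed.

End ZeroBracket.

Section RestrictForm.
Variables (R : realType) (V : vectType R) (g : {symmetric V}) (U : {vspace V}).

Definition restrict_form (x y : subvs_of U) : R := g (vsval x) (vsval y).

Lemma restrict_form_bilinear : bilinear_for
  (GRing.Scale.Law.clone _ _ *%R _) (GRing.Scale.Law.clone _ _ (idfun \; *%R) _)
  restrict_form.
Proof.
by split=> u a x y; rewrite /restrict_form linearP ?symDl ?symDr ?symZl ?symZr.
Qed.

HB.instance Definition _ :=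
  bilinear_isBilinear.Build R (subvs_of U) (subvs_of U) R _ _ restrict_form
    restrict_form_bilinear.

Lemma restrict_form_sym x y :
  restrict_form x y = (-1) ^+ false * idfun (restrict_form y x).
Proof. by rewrite expr0 mul1r /restrict_form symC. Qed.

HB.instance Definition _ :=
  isHermitianSesquilinear.Build R (subvs_of U) false idfun restrict_form
    restrict_form_sym.

End RestrictForm.

(** * The Levi-Civita product as a bilinear, skew and torsion-free product *)

Section LeviCivita.
Variables (R : realType) (V : vectType R) (g : {symmetric V}).
Variable br : {bilinear V -> V -> V}.
Hypothesis nd : nondegenerate g.
Local Notation L := (levi_civita g br).

Lemma levi_civita_bilinear : bilinear_for
  (GRing.Scale.Law.clone _ _ *:%R _) (GRing.Scale.Law.clone _ _ *:%R _) L.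
Proof.
have ext x y : (forall w, 2 * g x w = 2 * g y w) -> x = y.
  move=> xy; apply/eqP; rewrite -subr_eq0; apply/eqP.
  apply: (nondegenerateP nd) => w; rewrite symBl; have := xy w; lra.
split=> u a x y; apply: ext => w;
  rewrite symDl symZl mulrDr mulrCA !levi_civitaP// !linearPl !linearPr /= !symE;
  by ring.
Qed.

Hypothesis anti : antisymmetric_bracket br.

Lemma levi_civita_skew u v w : g (L u v) w = - g v (L u w).
Proof.
have := levi_civitaP nd br u v w; have := levi_civitaP nd br u w v.
by rewrite (anti w v) (anti v u) (anti w u) !symE (symC g v (L u w)); lra.
Qed.

Lemma levi_civita_torsion u v : L u v - L v u = br u v.
Proof.
apply/eqP; rewrite -subr_eq0; apply/eqP/(nondegenerateP nd) => w.
have := levi_civitaP nd br u v w; have := levi_civitaP nd br v u w.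
by rewrite (anti v u) (anti w v) (anti w u) !symE; lra.
Qed.

End LeviCivita.

(** * Reduction along a neutral null vector *)

Section Reduction.
Variables (R : realType) (V : vectType R) (g : {symmetric V}).
Variables br L : {bilinear V -> V -> V}.
Hypothesis nd : nondegenerate g.
Hypothesis skew : forall u v w, g (L u v) w = - g v (L u w).
Hypothesis torsion : forall u v, L u v - L v u = br u v.
Hypothesis flatL : forall u v w x,
  L (br (br u v) w) x - L (br u w) (L v x) - L u (L (br v w) x)
  + L v (L u (L w x)) - L w (L v (L u x)) = 0.
Variables (t e d : V).
Hypothesis t_pos : forall x, g t x = 0 -> x != 0 -> 0 < g x x.
Hypothesis nil : nilpotent_algebra br.
Hypotheses (e0 : e != 0) (ee : g e e = 0) (e_neutral : neutral L e).
Hypotheses (ed : g e d = 1) (dd : g d d = 0).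

Let U : {vspace V} := (orthov g <[e]> :&: orthov g <[d]>)%VS.
Let B : vectType R := subvs_of U.

Let memU x : (x \in U) = (g e x == 0) && (g d x == 0).
Proof. by rewrite memv_cap !mem_orthov1 !(symC g x). Qed.

Let valE (u : B) : g e (vsval u) = 0.
Proof. by have := subvsP u; rewrite memU => /andP[/eqP]. Qed.

Let valD (u : B) : g d (vsval u) = 0.
Proof. by have := subvsP u; rewrite memU => /andP[_ /eqP]. Qed.

Let gB : {symmetric B} := @restrict_form R V g U.
Let brB : {bilinear B -> B -> B} := abelian_structure B.

Let gBE (u v : B) : gB u v = g (vsval u) (vsval v). Proof. by []. Qed.

Let gB_pos : positive_definite gB.
Proof.
move=> u u0; rewrite gBE; apply: (lorentz_perp_pos t_pos e0 ee (valE u)).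
apply: contra u0 => /vlineP[c uE]; apply/eqP/val_inj; rewrite /= uE.
have := valD u; rewrite uE symZr symC ed mulr1 => ->.
by rewrite scale0r.
Qed.

Let gB_nd : nondegenerate gB := positive_nondegenerate gB_pos.

(** L u is skew, so L u d is orthogonal to d; being neutral, e is orthogonal to
    all products. *)
Let LdU u : L u d \in U.
Proof.
by rewrite memU (product_perp skew e_neutral) symC (skew0 skew) eqxx.
Qed.

Let xi : 'End(B) :=
  linfun ((@vsproj _ _ U) \o (applyr L d) \o (@vsval _ _ U) : {linear B -> B}).

Let val_xi (u : B) : vsval (xi u) = L (vsval u) d.
Proof. by rewrite lfunE /= vsprojK. Qed.

Let b0 : B := - vsproj U (L d d).

Let val_b0 : vsval b0 = - L d d.
Proof. by rewrite linearN /= vsprojK. Qed.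

Let proj (x : V) : V := x - g e x *: d - g d x *: e.

Let projU x : proj x \in U.
Proof.
by rewrite memU /proj !symE ee dd ed (symC g d e) ed; apply/andP; split; apply/eqP;
  ring.
Qed.

Let projK x : x = g e x *: d + proj x + g d x *: e.
Proof. by rewrite /proj -addrA subrK addrC subrK. Qed.

Let proj_uniq a w c : w \in U -> proj (a *: d + w + c *: e) = w.
Proof.
rewrite memU => /andP[/eqP ew /eqP dw].
rewrite /proj !symE ee dd ed (symC g d e) ed ew dw !(mulr0, mulr1, addr0, add0r).
by rewrite addrAC addrK addrAC subrr add0r.
Qed.

Let phi_fun (x : V) : dext B := (g e x, vsproj U (proj x), g d x).

Let phi_linear : linear phi_fun.
Proof.
move=> a x y; rewrite /phi_fun !symDr !symZr.
have -> : proj (a *: x + y) = a *: proj x + proj y.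
  rewrite /proj !symDr !symZr !scalerDl !scalerBr !scalerA !opprD.
  by rewrite [X in X + _]addrACA [LHS]addrACA.
by rewrite linearP.
Qed.

Let phi : {linear V -> dext B} := HB.pack_for {linear V -> dext B} phi_fun
  (GRing.isLinear.Build _ _ _ _ phi_fun phi_linear).

Let phi_bij : bijective phi.
Proof.
pose psi (y : dext B) : V :=
  let: (a, u, c) := y in a *: d + vsval u + c *: e.
exists psi => [x|[[a u] c]]; first by rewrite /= vsprojK ?projU// -projK.
rewrite /= /phi_fun proj_uniq ?subvsP// vsvalK.
by rewrite !symE ee dd ed (symC g d e) ed valE valD;
  congr (_, _, _); rewrite /=; ring.
Qed.

Let phi_isometry x y : dext_form gB (phi x) (phi y) = g x y.
Proof.
rewrite /dext_form /= gBE !vsprojK ?projU// /proj !symE ee dd ed (symC g d e) ed.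
by rewrite !(symC g x); ring.
Qed.

Let eproj x : g e (proj x) = 0.
Proof. by have := projU x; rewrite memU => /andP[/eqP]. Qed.

Let bracket_frame a p c a' q c' :
  br (a *: d + p + c *: e) (a' *: d + q + c' *: e)
    = a *: br d q - a' *: br d p + br p q.
Proof.
have eb z : br e z = 0 := neutral_bracket torsion z e_neutral.
have be z : br z e = 0 by rewrite (bracketC torsion) eb oppr0.
rewrite !linearDl !linearDr /= !linearZl_LR !linearZr_LR /=.
rewrite !eb !be !scaler0 !addr0 (bracketxx torsion) !scaler0 add0r.
by rewrite (bracketC torsion p d) scalerN addrA.
Qed.

Let bracket_expand x y :
  br x y = g e x *: br d (proj y) - g e y *: br d (proj x) + br (proj x) (proj y).
Proof. by rewrite {1}(projK x) {1}(projK y) bracket_frame. Qed.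

(** For x in e^perp, [d,x] = d.x - x.d, and d.x lies on the line of e. *)
Let bracket_mod_e x y : exists c,
  br x y = g e y *: L (proj x) d - g e x *: L (proj y) d + c *: e.
Proof.
have du u : g e u = 0 -> exists c, br d u = - L u d + c *: e.
  move=> eu; have /vlineP[c cE] :=
    product_line skew torsion flatL t_pos nil e0 ee e_neutral ed eu.
  by exists c; rewrite -cE -torsion addrC.
have [c1 E1] := du _ (eproj x); have [c2 E2] := du _ (eproj y).
have /vlineP[c3 E3] := perp_bracket_line skew torsion flatL t_pos nil e0 ee
  e_neutral (eproj x) (eproj y).
exists (g e x * c2 - g e y * c1 + c3).
rewrite bracket_expand E1 E2 E3 !scalerDr !scalerN !scalerA opprD opprK.
by rewrite addrACA (addrC (- (g e x *: L _ d))) -addrA -scalerBl -scalerDl.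
Qed.

Let bracket_d_coord x y : g d (br x y) =
  g e y * g (L d d) (proj x) - g e x * g (L d d) (proj y)
    - g (L (proj x) d) (proj y) + g (proj x) (L (proj y) d).
Proof.
have du u : g d (br d u) = - g (L d d) u.
  by rewrite -torsion symBr [g d (L u d)]symC (skew0 skew) subr0 skew opprK.
rewrite bracket_expand; move: (proj x) (proj y) => p q.
rewrite symDr symBr !symZr !du -torsion symBr.
rewrite (symC g d (L p q)) (symC g d (L q p)) (skew p q) (skew q p).
by rewrite (symC g q); ring.
Qed.

Let phi_bracket x y :
  phi (br x y) = dext_bracket brB gB (- xi) xi b0 0 (phi x) (phi y).
Proof.
rewrite /= /phi_fun /dext_bracket (bracket_perp skew torsion e_neutral).
congr (_, _, _).
  have [c cE] := bracket_mod_e x y.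
  have wU : g e y *: L (proj x) d - g e x *: L (proj y) d \in U.
    by apply: memvB; apply: memvZ.
  have -> : proj (br x y) = g e y *: L (proj x) d - g e x *: L (proj y) d.
    by rewrite -[RHS](proj_uniq 0 c wU) scale0r add0r -cE.
  move: (proj x) (proj y) (projU x) (projU y) wU => p q pU qU wU.
  apply/val_inj; rewrite /= vsprojK// !opp_lfunE addr0.
  by rewrite ![vsval (- _)]linearN /= !val_xi !vsprojK// !scalerN opprK addrC.
rewrite bracket_d_coord; move: (proj x) (proj y) (projU x) (projU y) => p q pU qU.
by rewrite symBl adjointP// !gBE !val_xi val_b0 !vsprojK// !symNl; ring.
Qed.

Let phi_lc : dext_levi_civita_table brB gB (- xi) xi b0 0.
Proof.
apply: dext_levi_civita_tableP => // u v.
by rewrite !opp_lfunE !addNr sym0l sym0r oppr0.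
Qed.

Let xi_sqr0 : (xi \o xi)%VF = 0.
Proof.
apply/lfunP => u; rewrite comp_lfunE zero_lfunE; apply/val_inj.
rewrite -[LHS]/(vsval (xi (xi u))) -[RHS]/(0 : V) !val_xi.
exact: (product_right_sqr0 skew torsion flatL t_pos nil e0 ee e_neutral ed).
Qed.

Lemma reduction_double_extension :
  pseudo_euclidean_malcev br g -> flat g br ->
  exists (B : vectType R) (brB : {bilinear B -> B -> B}) (gB : {symmetric B})
         (D xi : 'End(B)) (b0 : B),
    [/\ [/\ lie_algebra brB, abelian_bracket brB, positive_definite gB
          & flat gB brB],
        xi = - D,
        (xi \o xi)%VF = 0
      & flat_double_extension br g brB gB D xi b0 0].
Proof.
move=> malcev flat_br; exists B, brB, gB, (- xi), xi, b0.
split; [split|by rewrite opprK|exact: xi_sqr0|split=> //].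
- exact: zero_bracket_lie.
- by [].
- exact: gB_pos.
- exact: zero_bracket_flat.
- by split; [split; [exact: zero_bracket_malcev|exact: gB_nd]|exact: zero_bracket_flat].
- by exists phi; split; [exact: phi_bij|exact: phi_bracket|exact: phi_isometry].
Qed.

End Reduction.

Lemma null_dual (R : realType) (V : vectType R) (g : {symmetric V}) (e : V) :
  nondegenerate g -> e != 0 -> g e e = 0 -> exists d, g e d = 1 /\ g d d = 0.
Proof.
move=> nd e0 ee; have [v ev] : exists v, g e v != 0.
  apply: contrapT => no; case/eqP: e0; apply: (nondegenerateP nd) => w.
  by apply/eqP/negP => /negP ew; apply: no; exists w.
have [d1 ed1] : exists d1, g e d1 = 1.
  by exists ((g e v)^-1 *: v); rewrite symZr mulVf.
exists (d1 - (2^-1 * g d1 d1) *: e).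
by rewrite !symE ed1 ee (symC g d1 e) ed1; split; field.
Qed.

Theorem theorem4p5 (R : realType) (M : vectType R)
    (br : {bilinear M -> M -> M}) (g : {symmetric M})
    (hlor : lorentzian_malcev br g) (hflat : flat g br)
    (hnil : nilpotent_algebra br) :
  (exists (B : vectType R) (brB : {bilinear B -> B -> B}) (gB : {symmetric B})
          (D xi : 'End(B)) (b0 : B),
    [/\ [/\ lie_algebra brB, abelian_bracket brB, positive_definite gB
          & flat gB brB],
        xi = - D,
        (xi \o xi)%VF = 0
      & flat_double_extension br g brB gB D xi b0 0])
  /\ nilpotent_of_step_at_most br 3
  /\ (forall u v w z : M, br (br (br u v) w) z = 0).
Proof.
have [[[anti malcev] nd] dim2 sig] := hlor.
pose L : {bilinear M -> M -> M} := HB.pack_for {bilinear M -> M -> M}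
  (levi_civita g br)
  (bilinear_isBilinear.Build R M M M _ _ (levi_civita g br)
    (levi_civita_bilinear br nd)).
have skew : forall u v w, g (L u v) w = - g v (L u w) := levi_civita_skew nd anti.
have torsion : forall u v, L u v - L v u = br u v := levi_civita_torsion nd anti.
have [t [f [t_pos f0 ff]]] : exists t f : M, [/\ 
    forall x, g t x = 0 -> x != 0 -> 0 < g x x, f != 0 & g f f = 0].
  apply: lorentz_signature sig; by case: (\dim _) dim2 => [|[]].
have [e [e0 ee e_neutral]] :=
  null_neutral_exists nd skew torsion hflat t_pos hnil f0 ff.
have [d [ed dd]] := null_dual nd e0 ee.
have bbe := bracket_bracket_line skew torsion hflat t_pos hnil e0 ee e_neutral ed.
split.
  exact: (reduction_double_extension skew torsion hflat t_pos hnil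
    e0 ee e_neutral ed dd).
split; last by move=> u v w z; rewrite (bracket_linel torsion e_neutral z (bbe u v w)).
have lc2 : (lower_central br 2 <= <[e]>)%VS.
  apply/bracketvP => x w xVV _.
  pose adw : {linear M -> M} := applyr br w.
  rewrite -[br x w]/(adw x) -(lfunE adw) memv_preim; apply: subvP xVV.
  apply/bracketvP => u v _ _; rewrite -memv_preim lfunE; exact: bbe.
apply/eqP; rewrite -subv0; apply/bracketvP => x z xlc _.
by rewrite (bracket_linel torsion e_neutral z (subvP lc2 _ xlc)) mem0v.
Qed.
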